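(* Let $\mathcal{H}$ be a complex separable Hilbert space. For a fixed unitary operator $U$ on $\mathcal{H}$ and conjugations $C_1,C_2$ on $\mathcal{H}$, the following are equivalent. (a) $C_1UC_1=C_2UC_2$. (b) $C_1C_2$ is a unitary operator in the commutant of $U$.
   Context: A conjugation on a complex Hilbert space is an antilinear, isometric map $C$ with $C^2=I$. The commutant of $U$ is the set of all bounded linear operators $A$ on $\mathcal{H}$ with $AU=UA$. *)

(* Defs.v *)
From HB Require Import structures.
From mathcomp Require Import all_boot all_order all_algebra.
From mathcomp Require Import all_classical all_reals all_analysis.
From mathcomp Require Import complex.

Set Implicit Arguments.
Unset Strict Implicit.
Unset Printing Implicit Defensive.

Import Order.TTheory GRing.Theory Num.Theory.
Import numFieldNormedType.Exports.

Local Open Scope classical_set_scope.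
Local Open Scope ring_scope.
Local Open Scope complex_scope.

(* The norm of a normed module over R[i] is R[i]-valued (with values in the
   nonnegative reals), so inner_normE is an equation in R[i].  The inner product
   is linear in its first argument and conjugate-linear in its second one. *)
HB.mixin Record NormedModule_isHilbert (R : realType) H
    of CompleteNormedModule R[i] H := {
  inner : {dot H for (@Num.conj R[i])} ;
  inner_normE : forall x : H, `|x| ^+ 2 = inner x x
}.

#[short(type="hilbertType")]
HB.structure Definition Hilbert (R : realType) :=
  {H of NormedModule_isHilbert R H & CompleteNormedModule R[i] H}.

Definition separable (T : topologicalType) : Prop :=
  exists2 D : set T, countable D & dense D.

Section Operators.
Context {R : realType} {H : hilbertType R}.
Implicit Types A B C U : H -> H.

Definition bounded_linear A : Prop :=
  linear A /\ exists M : R, forall x, `|A x| <= M%:C * `|x|.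

Definition is_adjoint A B : Prop :=
  forall x y, inner (A x) y = inner x (B y).

(* The adjoint is unique, so B below is the operator usually written A^*. *)
Definition unitary A : Prop :=
  bounded_linear A /\
  exists B, [/\ bounded_linear B, is_adjoint A B, B \o A = id & A \o B = id].

Definition antilinear C : Prop :=
  GRing.linear_for (@Num.conj R[i] \; *:%R) C.

Definition conjugation C : Prop :=
  [/\ antilinear C, forall x, `|C x| = `|x| & C \o C = id].

Definition commutant U : set (H -> H) :=
  [set A | bounded_linear A /\ A \o U = U \o A].

End Operators.

(* Main.v *)
Require Import Defs.
From mathcomp Require Import all_boot all_order all_algebra.
From mathcomp Require Import all_classical all_reals all_analysis.
From mathcomp Require Import complex.

(* Since C1 and C2 are involutions, (a) and the relation "C1 C2 commutes with U"
   are obtained from each other by composing with C1 on the left and C2 on the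
   right.  The unitarity of C1 C2 is automatic: it is a linear isometry with
   inverse C2 C1, and by polarization linear isometries preserve the inner
   product, so C2 C1 is also the adjoint of C1 C2. *)

Import GRing.Theory Num.Theory.
Import numFieldNormedType.Exports.

Local Open Scope ring_scope.
Local Open Scope complex_scope.

Section Isometries.
Context {R : realType} {H : hilbertType R}.
Implicit Types (x y : H) (V C : H -> H).

(** Polarization rests on this expansion; the terms in [inner x x] and [inner y y] stand at the two
    ends, ready to be cancelled. *)
Lemma inner_scale_add (a : R[i]) x y :
  inner (a *: x + y) (a *: x + y) =
  Num.conj a * (a * inner x x) + Num.conj a * inner y x
    + (a * inner x y + inner y y).
Proof.
have innerZl u v : inner (a *: u) v = a * inner u v by exact: linearZl_LR.
have innerZr u v : inner u (a *: v) = Num.conj a * inner u v.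
  exact: linearZr_LR.
have innerDl u v w : inner (u + v) w = inner u w + inner v w.
  exact: linearDl.
have innerDr u v w : inner u (v + w) = inner u v + inner u w.
  exact: linearDr.
by rewrite innerDr !innerDl !innerZr !innerZl.
Qed.

Lemma inner_isometry V :
  linear V -> (forall x, `|V x| = `|x|) ->
  forall x y, inner (V x) (V y) = inner x y.
Proof.
move=> linV isoV x y.
have VE z : inner (V z) (V z) = inner z z by rewrite -!inner_normE isoV.
(* Equating the expansions for [a *: x + y] and its image leaves only the cross terms. *)
have polar (a : R[i]) :
    Num.conj a * (inner (V y) (V x) - inner y x)
    + a * (inner (V x) (V y) - inner x y) = 0.
  have := VE (a *: x + y); rewrite linV !inner_scale_add !VE.
  rewrite -!addrA => /addrI; rewrite !addrA => /addIr /eqP.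
  by rewrite -subr_eq0 opprD addrACA -!mulrBr => /eqP.
(* [a = 1] makes the two differences opposite; [a = 'i] then says that [2 'i] times the second one
   vanishes. *)
have := polar 1; rewrite rmorph1 !mul1r => /eqP; rewrite addr_eq0 => /eqP yxE.
have := polar 'i; rewrite yxE conjCi mulrNN -mulr2n -mulr_natr => /eqP.
by rewrite !mulf_eq0 pnatr_eq0 orbF (negPf (neq0Ci _)) subr_eq0 => /eqP.
Qed.

(** Each scalar is conjugated twice. *)
Lemma conjugation_comp_linear C1 C2 :
  conjugation C1 -> conjugation C2 -> linear (C1 \o C2).
Proof. by move=> [lin1 _ _] [lin2 _ _] a x y; rewrite /= lin2 lin1 /= conjCK. Qed.

Lemma conjugation_comp_isometry C1 C2 :
  conjugation C1 -> conjugation C2 -> forall x, `|(C1 \o C2) x| = `|x|.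
Proof. by move=> [_ iso1 _] [_ iso2 _] x; rewrite /= iso1 iso2. Qed.

Lemma conjugation_comp_cancel C1 C2 :
  conjugation C1 -> conjugation C2 -> (C1 \o C2) \o (C2 \o C1) = id.
Proof.
move=> [_ _ inv1] [_ _ inv2].
(* Composition is associative by conversion, so regrouping needs no lemma. *)
by rewrite -[LHS]/(C1 \o (C2 \o C2) \o C1) inv2.
Qed.

Lemma isometry_bounded_linear V :
  linear V -> (forall x, `|V x| = `|x|) -> bounded_linear V.
Proof. by move=> linV isoV; split=> //; exists 1 => x; rewrite isoV mul1r. Qed.

Lemma conjugation_comp_unitary C1 C2 :
  conjugation C1 -> conjugation C2 -> unitary (C1 \o C2).
Proof.
move=> conj1 conj2.
have lin12 := conjugation_comp_linear _ _ conj1 conj2.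
have lin21 := conjugation_comp_linear _ _ conj2 conj1.
have iso12 := conjugation_comp_isometry _ _ conj1 conj2.
have iso21 := conjugation_comp_isometry _ _ conj2 conj1.
have can12 := conjugation_comp_cancel _ _ conj1 conj2.
have can21 := conjugation_comp_cancel _ _ conj2 conj1.
split; first exact: isometry_bounded_linear.
exists (C2 \o C1); split=> //; first exact: isometry_bounded_linear.
(* Applying the isometry [C2 \o C1] to both arguments undoes [C1 \o C2] in the first. *)
move=> x y; rewrite -(inner_isometry _ lin21 iso21 ((C1 \o C2) x)).
by rewrite (congr1 (@^~ x) can21 : (C2 \o C1) ((C1 \o C2) x) = x).
Qed.

End Isometries.

Theorem proposition2p22 (R : realType) (H : hilbertType R)
  (sepH : separable H) (U C1 C2 : H -> H)
  (unitaryU : unitary U) (conjC1 : conjugation C1) (conjC2 : conjugation C2) :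
  C1 \o U \o C1 = C2 \o U \o C2
  <-> unitary (C1 \o C2) /\ commutant U (C1 \o C2).
Proof.
have unitary12 := conjugation_comp_unitary _ _ conjC1 conjC2.
have [_ _ inv1] := conjC1; have [_ _ inv2] := conjC2.
split=> [eqU|[_ [_ comm]]].
  split=> //; split; first exact: unitary12.1.
  (* Inserting [C1 \o C1] in front of [U] exposes [C1 \o U \o C1]. *)
  rewrite -[RHS]/(id \o (U \o C1) \o C2) -inv1.
  rewrite -[RHS]/(C1 \o (C1 \o U \o C1) \o C2) eqU.
  by rewrite -[RHS]/(C1 \o C2 \o U \o (C2 \o C2)) inv2.
(* Inserting [C2 \o C2] at the end exposes [C1 \o C2], which can then pass to the left of [U]. *)
rewrite -[LHS]/(C1 \o U \o C1 \o id) -inv2.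
rewrite -[LHS]/(C1 \o (U \o (C1 \o C2)) \o C2) -comm.
by rewrite -[LHS]/((C1 \o C1) \o (C2 \o U \o C2)) inv1.
Qed.
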